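(* Let $q\in\widetilde{\mathbb C}$ and $a,b\in\mathbb C$ with $ab\neq0$, $a\neq q^{-\frac12}$, and, for all $n\ge0$, $a\neq q^{-n-1}$, $b\neq q^{-n-1}$, $ab\neq q^{-n}$. Let $u$ be the symmetrical form such that $\sigma u=\mathcal U(a,b,q)$. Then $u$ is $H_{\sqrt q}$-semiclassical of class one and satisfies $$H_{\sqrt q}\big(x(x^2-b^{-1}q^{-1})u\big)+\big(abq^2(\sqrt q-1)\big)^{-1}\big((1-abq^2)x^2+aq-1\big)u=0 .$$ Its recurrence coefficients are, for $n\ge0$, $$\gamma_{2n+1}=q^n\frac{(1-aq^{n+1})(1-abq^{n+1})}{(1-abq^{2n+1})(1-abq^{2n+2})},\qquad \gamma_{2n+2}=aq^{n+1}\frac{(1-q^{n+1})(1-bq^{n+1})}{(1-abq^{2n+2})(1-abq^{2n+3})} .$$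
   Context: $\mathcal P$ is the vector space of polynomials in one variable with complex coefficients and $\mathcal P'$ its dual; elements of $\mathcal P'$ are called forms; $\langle u,f\rangle$ is the action of $u$ on $f$ and $(u)_n=\langle u,x^n\rangle$ are the moments. All regular forms are normalized by $(u)_0=1$. A form is symmetrical if $(u)_{2n+1}=0$ for all $n\ge0$. Let $\widetilde{\mathbb C}=\{z\in\mathbb C: z\neq0,\ z^n\neq1\ \forall n\ge1\}$; $\sqrt{q}=q^{1/2}$ is the principal square root. For a polynomial $g$, $\langle gu,f\rangle=\langle u,gf\rangle$. For $r\in\widetilde{\mathbb C}$, $(H_rf)(x)=\frac{f(rx)-f(x)}{(r-1)x}$ and $\langle H_ru,f\rangle=-\langle u,H_rf\rangle$. The form $\sigma u$ is defined by $\langle\sigma u,f\rangle=\langle u,f(x^2)\rangle$. A form $u$ is regular if there is a sequence of monic polynomials $\{B_n\}_{n\ge0}$, $\deg B_n=n$, with $\langle u,B_mB_n\rangle=r_n\delta_{n,m}$, $r_n\ne0$; then $B_0=1$, $B_1=x-\beta_0$, $B_{n+2}=(x-\beta_{n+1})B_{n+1}-\gamma_{n+1}B_n$ with $\gamma_{n+1}\neq0$, $n\ge0$ (for symmetrical $u$ all $\beta_n=0$); the $\gamma_{n+1}$ are the recurrence coefficients. A form $u$ is $H_r$-semiclassical if it is regular and $H_r(\Phi u)+\Psi u=0$ for some polynomials $\Phi$ (monic, degree $t\ge0$) and $\Psi$ (degree $p\ge1$). It is of class $s=\max(p-1,t-2)$ if the pair $(\Phi,\Psi)$ satisfies $$\prod_{c\in\mathcal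 Z_\Phi}\Big\{\big|r\Psi(rc)+(H_r\Phi)(c)\big|+\big|\langle u,\ r(\theta_{cr}\Psi)+\theta_{cr}(\theta_c\Phi)\rangle\big|\Big\}>0,$$ where $\mathcal Z_\Phi$ is the set of zeros of $\Phi$ and $(\theta_cf)(x)=\frac{f(x)-f(c)}{x-c}$. $\mathcal U(a,b,q)$ (the little $q$-Jacobi form) is the form with $(\mathcal U(a,b,q))_0=1$ satisfying $H_q\big(x(x-b^{-1}q^{-1})\mathcal U(a,b,q)\big)+\big(abq^2(q-1)\big)^{-1}\big((1-abq^2)x+aq-1\big)\mathcal U(a,b,q)=0$. *)

(* Defs.v *)
(* MathComp and MathComp-Analysis; the complex field is R[i], R a realType. *)
From HB Require Import structures.
From mathcomp Require Import all_boot all_order all_algebra.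
From mathcomp Require Import classical_sets fsbigop reals complex.

Set Implicit Arguments.
Unset Strict Implicit.
Unset Printing Implicit Defensive.

Import Order.TTheory GRing.Theory Num.Theory.
Local Open Scope ring_scope.

Section Operators.
Variable C : fieldType.
Implicit Types (f g : {poly C}) (r c : C).

(* The two difference quotients are polynomial quotients; they are exact by
   hahnE and thetaE below. *)
Definition hahn r f : {poly C} := (f \Po (r *: 'X) - f) %/ ((r - 1) *: 'X).

Definition theta c f : {poly C} := (f - f.[c]%:P) %/ ('X - c%:P).

Lemma hahnE r f : r != 1 -> hahn r f * ((r - 1) *: 'X) = f \Po (r *: 'X) - f.
Proof.
move=> r1; apply/divpK; rewrite dvdpZl ?subr_eq0 //.
have -> : 'X = 'X - 0%:P :> {poly C} by rewrite subr0.
rewrite dvdp_XsubCl /root hornerD hornerN horner_comp.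
by rewrite subr0 hornerZ hornerX mulr0 subrr.
Qed.

Lemma thetaE c f : theta c f * ('X - c%:P) = f - f.[c]%:P.
Proof.
by apply/divpK; rewrite dvdp_XsubCl /root hornerD hornerN hornerC subrr.
Qed.

Lemma hahn_linear r : linear (hahn r).
Proof.
move=> k f g; rewrite /hahn -divpZl -divpD; congr (_ %/ _).
by rewrite comp_polyD comp_polyZ scalerBr opprD addrACA.
Qed.

HB.instance Definition _ r :=
  GRing.isLinear.Build C {poly C} {poly C} *:%R (hahn r) (hahn_linear r).

End Operators.

Section Forms.
Variable C : fieldType.
Implicit Types (f g Phi Psi : {poly C}) (u v : {scalar {poly C}}).

Definition mul_form g u : {poly C} -> C := fun f => u (g * f).

Lemma mul_form_scalar g u : scalar (mul_form g u).
Proof. by move=> k f h; rewrite /mul_form mulrDr -scalerAr linearP. Qed.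

HB.instance Definition _ g u :=
  GRing.isLinear.Build C {poly C} C *%R (mul_form g u) (mul_form_scalar g u).

Definition hahn_form (r : C) u : {poly C} -> C := fun f => - u (hahn r f).

Lemma hahn_form_scalar r u : scalar (hahn_form r u).
Proof. by move=> k f h; rewrite /hahn_form !linearP opprD mulrN. Qed.

HB.instance Definition _ r u :=
  GRing.isLinear.Build C {poly C} C *%R (hahn_form r u) (hahn_form_scalar r u).

Definition sigma_form u : {poly C} -> C := fun f => u (f \Po 'X^2).

Lemma sigma_form_scalar u : scalar (sigma_form u).
Proof. by move=> k f h; rewrite /sigma_form comp_polyD comp_polyZ linearP. Qed.

HB.instance Definition _ u :=
  GRing.isLinear.Build C {poly C} C *%R (sigma_form u) (sigma_form_scalar u).

Definition moment u (n : nat) : C := u 'X^n.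

Definition symmetrical u := forall n : nat, moment u n.*2.+1 = 0.

(* H_r(Phi u) + Psi u = 0, as an equality of forms. *)
Definition hahn_equation (r : C) Phi Psi u :=
  hahn_form r (mul_form Phi u) \+ mul_form Psi u =1 (fun=> 0).

Definition monic_orthogonal u (B : nat -> {poly C}) :=
  (forall n, (B n \is monic) /\ size (B n) = n.+1) /\
  exists2 r : nat -> C, (forall n, r n != 0)
    & (forall m n, u (B m * B n) = r n *+ (n == m)).

(* Regular forms are normalized by (u)_0 = 1. *)
Definition regular u :=
  moment u 0 = 1 /\ exists B : nat -> {poly C}, monic_orthogonal u B.

(* The value gamma 0 plays no role. *)
Definition recurrence_coefficients u (beta gamma : nat -> C) :=
  exists2 B : nat -> {poly C}, monic_orthogonal u B
    & [/\ B 0 = 1,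
          B 1 = 'X - (beta 0)%:P
        & forall n, gamma n.+1 != 0 /\
            B n.+2 = ('X - (beta n.+1)%:P) * B n.+1 - gamma n.+1 *: B n].

Definition semiclassical_pair (r : C) Phi Psi u :=
  [/\ Phi \is monic, (1 < size Psi)%N & hahn_equation r Phi Psi u].

Definition semiclassical (r : C) u :=
  regular u /\ exists Phi Psi, semiclassical_pair r Phi Psi u.

End Forms.

(* The product ranges over the set of zeros of Phi, without multiplicity; this
   set is finite as soon as Phi is monic. *)
Definition class_condition (C : numClosedFieldType) (r : C)
    (Phi Psi : {poly C}) (u : {scalar {poly C}}) :=
  0 < \big[*%R/1]_(c \in [set c : C | root Phi c]%classic)
        (`|r * Psi.[r * c] + (hahn r Phi).[c]|
         + `|u (r *: theta (c * r) Psi + theta (c * r) (theta c Phi))|).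

(* With t = deg Phi and p = deg Psi >= 1, truncated subtraction in
   max (p - 1) (t - 2) is harmless. *)
Definition semiclassical_of_class (C : numClosedFieldType) (r : C)
    (u : {scalar {poly C}}) (s : nat) :=
  regular u /\
  exists Phi Psi, [/\ semiclassical_pair r Phi Psi u,
    class_condition r Phi Psi u
    & s = maxn ((size Psi).-1 - 1) ((size Phi).-1 - 2)].

Definition in_Ctilde (C : fieldType) (z : C) :=
  z != 0 /\ forall n : nat, (0 < n)%N -> z ^+ n != 1.

(* The equations that characterize the little q-Jacobi form U(a, b, q). *)
Definition little_qJacobi (C : fieldType) (a b q : C) (v : {scalar {poly C}}) :=
  moment v 0 = 1 /\
  hahn_equation q ('X * ('X - (b^-1 * q^-1)%:P))
    ((a * b * q ^+ 2 * (q - 1))^-1 *: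
       ((1 - a * b * q ^+ 2) *: 'X + (a * q - 1)%:P)) v.

(* Main.v *)
Require Import Defs.
From HB Require Import structures.
From mathcomp Require Import all_boot all_order all_algebra.
From mathcomp Require Import classical_sets fsbigop reals complex.
From mathcomp Require Import ring.

Set Implicit Arguments.
Unset Strict Implicit.
Unset Printing Implicit Defensive.

Import Order.TTheory GRing.Theory Num.Theory.
Local Open Scope ring_scope.

(** The odd moments of [u] vanish and its even moments are those of [U].
    Pairing the equation of [U] with ['X^n] gives
    [(1 - a b q^(n+2)) (U)_(n+1) = (1 - a q^(n+1)) (U)_n]
    ([little_qJacobi_moment_rec]), hence the moments
    [(aq; q)_n / (abq^2; q)_n] ([even_moment]). With [p] the
    square root of [q], the equation announced for [u], paired with ['X^(2n)],
    is exactly the same recurrence ([sym_hahn_equation]).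

    For the recurrence coefficients, start from the claimed [gamma], let [B] be
    the polynomials that it generates, and show that they are orthogonal for
    [u]. By symmetry only the mixed moments [u ('X^k * B n)] with [k] and [n] of
    the same parity matter, and these have a closed form ([mixed_moments]):
    for [k = 2k'], [n = 2n'], or [k = 2k'+1], [n = 2n'+1], it is a constant
    times the product of the [q^k' - q^j], [j < n'], times a quotient of
    q-Pochhammer symbols. The product is zero for [k' < n'], which is
    orthogonality; the squared norms are products of [gamma]s, nonzero by the
    hypotheses on [a], [b] and [a b] ([sym_ops_orthogonal]). This gives
    regularity together with the coefficients.

    For the class, at the zero [c = 0] of ['X * ('X^2 - b^-1 q^-1)] the first
    term of the condition is [a p - 1] up to a nonzero factor, which is where
    [a != p^-1] enters; at the other zeros, the second term is [1 - a b q] up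
    to a nonzero factor ([class_condition_sym]). *)

(** * The Hahn operator on monomials *)

Section HahnMonomials.
Variable C : fieldType.
Implicit Types (u v : {scalar {poly C}}) (r c : C).

Lemma scalar_eq0 v : (forall n, v 'X^n = 0) -> v =1 (fun=> 0).
Proof.
move=> v0 f; rewrite -[f]coefK poly_def linear_sum big1 // => i _.
by rewrite scalarZ v0 mulr0.
Qed.

(** The factor ['X] absorbs the shift of exponent, so that [n = 0] needs no
    separate treatment. *)
Lemma mulX_hahnXn r n : r != 1 ->
  'X * hahn r 'X^n = ((r ^+ n - 1) / (r - 1)) *: 'X^n.
Proof.
move=> r1; have r10 : r - 1 != 0 by rewrite subr_eq0.
have X0 : (r - 1) *: 'X != 0 :> {poly C} by rewrite scaler_eq0 negb_or r10 polyX_eq0.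
apply: (mulIf X0); rewrite -mulrA hahnE // comp_Xn_poly exprZn -scalerAl -scalerAr.
rewrite scalerA divfK // -{2}['X^n]scale1r -scalerBl -scalerAr.
by rewrite -exprSr -exprS.
Qed.

Lemma hahn_equationXP r (g Psi : {poly C}) u : r != 1 ->
  hahn_equation r ('X * g) Psi u <->
  forall n, (r ^+ n - 1) / (r - 1) * u (g * 'X^n) = u (Psi * 'X^n).
Proof.
move=> r1.
have E n : (hahn_form r (mul_form ('X * g) u) \+ mul_form Psi u) 'X^n =
    u (Psi * 'X^n) - (r ^+ n - 1) / (r - 1) * u (g * 'X^n).
  rewrite /= /hahn_form /= /mul_form -[_ * _ * hahn _ _]mulrA mulrCA mulX_hahnXn //.
  by rewrite -scalerAr scalarZ addrC.
split=> [Hu n|Hu].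
  by apply/esym/eqP; rewrite -subr_eq0; apply/eqP; rewrite -E; apply: Hu.
by apply: scalar_eq0 => n; rewrite [LHS]E Hu subrr.
Qed.

(** Pairing the equation with ['X^n] turns it into a two-term recurrence. *)
Lemma little_qJacobi_moment_rec (a b q : C) v n :
  q != 0 -> q != 1 -> a * b != 0 -> little_qJacobi a b q v ->
  (1 - a * b * q ^+ n.+2) * moment v n.+1 = (1 - a * q ^+ n.+1) * moment v n.
Proof.
move=> q0 q1; rewrite mulf_eq0 negb_or => /andP[a0 b0] [_].
have q10 : q - 1 != 0 by rewrite subr_eq0.
move/(hahn_equationXP _ _ _ q1)/(_ n).
rewrite [(_ - _) * 'X^n]mulrBl -exprS mul_polyC.
rewrite -scalerAl [(_ + _) * 'X^n]mulrDl -scalerAl -exprS mul_polyC.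
rewrite linearB /= !scalarZ linearD /= !scalarZ -!/(moment v _).
set m1 := moment v n.+1; set m0 := moment v n => H.
apply/eqP; rewrite -subr_eq0.
have -> : (1 - a * b * q ^+ n.+2) * m1 - (1 - a * q ^+ n.+1) * m0 =
    ((a * b * q ^+ 2 * (q - 1))^-1 *
       ((1 - a * b * q ^+ 2) * m1 + (a * q - 1) * m0) -
     (q ^+ n - 1) / (q - 1) * (m1 - b^-1 / q * m0)) *
    (a * b * q ^+ 2 * (q - 1)).
  by rewrite !exprS; field; rewrite q10 a0 b0 q0.
by rewrite H subrr mul0r.
Qed.

(** Pairing with an odd power of ['X] gives odd moments, hence nothing; with
    ['X^(2 * n)], the quotient [(p ^+ (2 * n) - 1) / (p - 1)] is
    [(q ^+ n - 1) / (p - 1)], and what remains is the moment recurrence of the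
    little q-Jacobi form up to the constant [a * b * q ^+ 2 * (p - 1)]. *)
Lemma sym_hahn_equation (a b q p : C) u :
  q != 0 -> q != 1 -> a * b != 0 -> p ^+ 2 = q -> symmetrical u ->
  (forall n, (1 - a * b * q ^+ n.+2) * moment u n.+1.*2 =
             (1 - a * q ^+ n.+1) * moment u n.*2) ->
  hahn_equation p ('X * ('X^2 - (b^-1 * q^-1)%:P))
    ((a * b * q ^+ 2 * (p - 1))^-1 *:
       ((1 - a * b * q ^+ 2) *: 'X^2 + (a * q - 1)%:P)) u.
Proof.
move=> q0 q1; rewrite mulf_eq0 negb_or => /andP[a0 b0] pq usym urec.
have p1 : p != 1 by apply: contraNneq q1 => p1; rewrite -pq p1 expr1n.
have p10 : p - 1 != 0 by rewrite subr_eq0.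
apply/(hahn_equationXP _ _ _ p1) => n.
rewrite [(_ - _) * 'X^n]mulrBl -exprD mul_polyC.
rewrite -scalerAl [(_ + _) * 'X^n]mulrDl -scalerAl -exprD mul_polyC.
rewrite linearB /= !scalarZ linearD /= !scalarZ -!/(moment u _) add2n.
rewrite -[n]odd_double_half; case: (odd n); rewrite ?add1n ?add0n.
  by rewrite -doubleS !usym !mulr0 subrr addr0 !mulr0.
rewrite -doubleS -mul2n exprM pq; move: (urec n./2); rewrite mul2n.
set M1 := moment u _; set M := moment u _ => rec.
apply/eqP; rewrite -subr_eq0.
have -> : (q ^+ n./2 - 1) / (p - 1) * (M1 - b^-1 / q * M) -
    (a * b * q ^+ 2 * (p - 1))^-1 * ((1 - a * b * q ^+ 2) * M1 + (a * q - 1) * M) =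
    ((1 - a * q ^+ n./2.+1) * M - (1 - a * b * q ^+ n./2.+2) * M1) /
    (a * b * q ^+ 2 * (p - 1)).
  by rewrite !exprS; field; rewrite p10 a0 b0 q0.
by rewrite rec subrr mul0r.
Qed.

End HahnMonomials.

(** * Symmetric three-term recurrences *)

Section SymmetricRecurrence.
Variable C : fieldType.
Implicit Types (u : {scalar {poly C}}) (gamma : nat -> C).

Fixpoint sym_ops gamma n : {poly C} :=
  match n with
  | 0 => 1
  | n1.+1 => match n1 with
             | 0 => 'X
             | n2.+1 => 'X * sym_ops gamma n1 - gamma n1 *: sym_ops gamma n2
             end
  end.

Lemma sym_opsSS gamma n :
  sym_ops gamma n.+2 = 'X * sym_ops gamma n.+1 - gamma n.+1 *: sym_ops gamma n.
Proof. by []. Qed.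

Lemma size_monic_sym_ops gamma n :
  size (sym_ops gamma n) = n.+1 /\ sym_ops gamma n \is monic.
Proof.
elim/ltn_ind: n => -[_|[_|n IH]]; first by rewrite size_poly1 monic1.
  by rewrite size_polyX monicX.
have [[s1 m1] [s0 _]] := (IH n.+1 (ltnSn _), IH n (leqnSn _)).
have B10 : sym_ops gamma n.+1 != 0 by rewrite -size_poly_gt0 s1.
have sX : size ('X * sym_ops gamma n.+1) = n.+3.
  by rewrite -commr_polyX size_mulX // s1.
have lt_s : (size (- (gamma n.+1 *: sym_ops gamma n)) <
             size ('X * sym_ops gamma n.+1)%R)%N.
  rewrite size_polyN sX; apply: leq_ltn_trans (size_scale_leq _ _) _.
  by rewrite s0.
rewrite sym_opsSS; split; first by rewrite size_polyDl.
by rewrite monicE lead_coefDl // -commr_polyX lead_coefMX.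
Qed.

Lemma mixed_momentSS gamma u n k :
  u ('X^k * sym_ops gamma n.+2) =
  u ('X^(k.+1) * sym_ops gamma n.+1) - gamma n.+1 * u ('X^k * sym_ops gamma n).
Proof.
rewrite sym_opsSS mulrBr -scalerAr linearB /= scalarZ /= mulrA.
by rewrite -exprSr.
Qed.

(** Each [sym_ops gamma n] has the parity of [n]. *)
Lemma mixed_moment_odd gamma u n k : symmetrical u -> odd (k + n) ->
  u ('X^k * sym_ops gamma n) = 0.
Proof.
move=> usym.
have momE j : odd j -> u 'X^j = 0.
  by move=> oj; rewrite -(odd_double_half j) oj; apply: usym.
elim/ltn_ind: n k => -[_|[_|n IH]] k okn.
- by rewrite mulr1 momE // -[k]addn0.
- by rewrite -exprSr momE // -addn1.
- rewrite mixed_momentSS !IH ?mulr0 ?subr0 //.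
  + by move: okn; rewrite !addnS /= negbK.
  + by rewrite addSnnS; move: okn; rewrite !addnS /= negbK.
Qed.

(** Since [u ('X^n * B n.+2) = 0], [mixed_momentSS] gives
    [u ('X^(n.+1) * B n.+1) = gamma n.+1 * u ('X^n * B n)], where
    [B = sym_ops gamma]: the squared norms are the products of the [gamma]s. *)
Lemma sym_ops_orthogonal gamma u :
  moment u 0 = 1 -> symmetrical u -> (forall n, gamma n.+1 != 0) ->
  (forall n k, (k < n)%N -> u ('X^k * sym_ops gamma n) = 0) ->
  monic_orthogonal u (sym_ops gamma).
Proof.
move=> u0 usym g0 vanish; split.
  by move=> n; have [-> ->] := size_monic_sym_ops gamma n.
have vanish_poly n (p : {poly C}) : (size p <= n)%N -> u (p * sym_ops gamma n) = 0.
  move=> sp; rewrite -[p]coefK poly_def mulr_suml linear_sum big1 // => i _.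
  rewrite -scalerAl scalarZ /= vanish ?mulr0 //.
  exact: leq_trans (ltn_ord i) sp.
exists (fun n => u ('X^n * sym_ops gamma n)).
  elim=> [|n IH]; first by rewrite mulr1 [u _]u0 oner_neq0.
  have /eqP := mixed_momentSS gamma u n n.
  rewrite vanish // eq_sym subr_eq0 => /eqP ->.
  by rewrite mulf_neq0.
move=> m n; case: (ltngtP n m) => [lt_nm|lt_mn|->].
- rewrite mulrC (vanish_poly m) //.
  by rewrite (size_monic_sym_ops gamma n).1.
- rewrite (vanish_poly n) //.
  by rewrite (size_monic_sym_ops gamma m).1.
(* ['X^m] and [sym_ops gamma m] are both monic of degree [m], so their
   difference has degree less than [m]. *)
- rewrite mulr1n; apply/eqP; rewrite -subr_eq0 -linearB -mulrBl /=.
  apply/eqP; apply: vanish_poly.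
  have [sB mB] := size_monic_sym_ops gamma m.
  apply/leq_sizeP => j le_mj; rewrite coefB coefXn.
  case: ltngtP le_mj => // [lt_mj|<-] _.
    by rewrite subr0 nth_default // sB.
  by move/monicP: mB; rewrite /lead_coef sB /= => ->; rewrite subrr.
Qed.

Lemma sym_ops_recurrence gamma u :
  (forall n, gamma n.+1 != 0) -> monic_orthogonal u (sym_ops gamma) ->
  recurrence_coefficients u (fun=> 0) gamma.
Proof.
move=> g0 oB; exists (sym_ops gamma) => //; split=> // [|n].
  by rewrite subr0.
by rewrite subr0.
Qed.

End SymmetricRecurrence.

(** * Mixed moments of the symmetrized little q-Jacobi form *)

Section MixedMoments.
Variables (C : fieldType) (a b q : C).

(** The q-Pochhammer symbol [(x; q)_n]. *)
Definition qpoch x n : C := \prod_(j < n) (1 - x * q ^+ j).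

(** The monic polynomial with the zeros [1, q, ..., q^(n-1)], taken at [q^k]:
    the factor of the mixed moments that carries orthogonality. *)
Definition qvanish n k : C := \prod_(j < n) (q ^+ k - q ^+ j).

Definition gamma_odd n : C :=
  q ^+ n * ((1 - a * q ^+ (n + 1)) * (1 - a * b * q ^+ (n + 1)))
  / ((1 - a * b * q ^+ (2 * n + 1)) * (1 - a * b * q ^+ (2 * n + 2))).

Definition gamma_even n : C :=
  a * q ^+ (n + 1) * ((1 - q ^+ (n + 1)) * (1 - b * q ^+ (n + 1)))
  / ((1 - a * b * q ^+ (2 * n + 2)) * (1 - a * b * q ^+ (2 * n + 3))).

Definition sym_gamma n : C :=
  if odd n then gamma_odd n./2 else gamma_even n./2.-1.

Lemma sym_gamma_odd n : sym_gamma n.*2.+1 = gamma_odd n.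
Proof. by rewrite /sym_gamma /= odd_double uphalf_double. Qed.

Lemma sym_gamma_even n : sym_gamma n.*2.+2 = gamma_even n.
Proof. by rewrite /sym_gamma /= odd_double /= doubleK. Qed.

Lemma qpochS x n : qpoch x n.+1 = qpoch x n * (1 - x * q ^+ n).
Proof. by rewrite /qpoch big_ord_recr. Qed.

Lemma qvanishS n k : qvanish n.+1 k = qvanish n k * (q ^+ k - q ^+ n).
Proof. by rewrite /qvanish big_ord_recr. Qed.

Lemma qvanish_eq0 n k : (k < n)%N -> qvanish n k = 0.
Proof.
by move=> lt_kn; rewrite /qvanish (bigD1 (Ordinal lt_kn)) //= subrr mul0r.
Qed.

Lemma qvanishSS n k : qvanish n.+1 k.+1 = (q ^+ k.+1 - 1) * q ^+ n * qvanish n k.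
Proof.
rewrite /qvanish big_ord_recl expr0 -mulrA; congr (_ * _).
under eq_bigr => j _ do rewrite lift0 !exprS -mulrBr.
by rewrite big_split /= prodr_const card_ord.
Qed.

Hypotheses (hq : in_Ctilde q) (hab : a * b != 0).
Hypotheses (ha : forall n : nat, a != q ^- n.+1)
           (hb : forall n : nat, b != q ^- n.+1)
           (habq : forall n : nat, a * b != q ^- n).

Lemma q_neq0 : q != 0. Proof. by case: hq. Qed.

Lemma subr1_neq0 x n : x != q ^- n -> 1 - x * q ^+ n != 0.
Proof.
apply: contra_neq => /subr0_eq xq.
by rewrite -[x](mulfK (expf_neq0 n q_neq0)) -xq mul1r.
Qed.

Lemma qpoch_neq0 n : qpoch (a * b * q ^+ 2) n != 0.
Proof.
apply/prodf_neq0 => j _.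
by rewrite -mulrA -exprD subr1_neq0.
Qed.

Lemma sym_gamma_neq0 n : sym_gamma n.+1 != 0.
Proof.
have [[q0 q1] [a0 b0]] : (in_Ctilde q) * (a != 0 /\ b != 0).
  by split=> //; apply/andP; rewrite -negb_or -mulf_eq0.
rewrite -(odd_double_half n); case: (odd n) => /=.
  rewrite add1n sym_gamma_even /gamma_even addn1.
  rewrite !mulf_neq0 ?invr_eq0 ?mulf_neq0 ?expf_neq0 ?subr1_neq0 //.
  by rewrite subr_eq0 eq_sym q1.
rewrite add0n sym_gamma_odd /gamma_odd addn1.
by rewrite !mulf_neq0 ?invr_eq0 ?mulf_neq0 ?expf_neq0 ?subr1_neq0.
Qed.

Variable u : {scalar {poly C}}.
Hypotheses (u0 : moment u 0 = 1) (usym : symmetrical u).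
Hypothesis u_rec : forall n,
  (1 - a * b * q ^+ n.+2) * moment u n.+1.*2 =
  (1 - a * q ^+ n.+1) * moment u n.*2.

Lemma even_moment n :
  moment u n.*2 = qpoch (a * q) n / qpoch (a * b * q ^+ 2) n.
Proof.
elim: n => [|n IH]; first by rewrite /qpoch !big_ord0 divr1.
have D0 : 1 - a * b * q ^+ n.+2 != 0 by rewrite subr1_neq0.
apply: (mulfI D0); rewrite u_rec IH !qpochS.
have := qpoch_neq0 n; move: (qpoch _ n) (qpoch _ n) D0 => N D.
rewrite (exprD q 2 n) (exprS q n) => D0 P0.
by field; rewrite -mulrA D0 P0.
Qed.

Local Notation B := (sym_ops sym_gamma).

(** Induction on [n] through [mixed_momentSS]. Divided by the common factors,
    each step is an identity of degree one in [q ^+ k]; vanishing at [k = n]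
    forces the value of [gamma], and the leading coefficient gives the new
    constant. The induction step uses only the ratio of the odd constant to the
    even one, so the even one is left existential. *)
Lemma mixed_moments n : exists c, forall k,
  u ('X^(k.*2) * B n.*2) =
    c * qvanish n k * (qpoch (a * q) k / qpoch (a * b * q ^+ 2) (n + k))
  /\
  u ('X^(k.*2.+1) * B n.*2.+1) =
    c * (q ^+ n * (1 - a * b * q ^+ n.+1) / (1 - a * b * q ^+ n.*2.+1)) *
    qvanish n k * (qpoch (a * q) k.+1 / qpoch (a * b * q ^+ 2) (n + k).+1).
Proof.
have D0 m : 1 - a * b * q ^+ m != 0 by rewrite subr1_neq0.
elim: n => [|n [c IH]].
  exists 1 => k; split.
    by rewrite mulr1 [LHS]even_moment /qvanish big_ord0 !mul1r.
  rewrite [LHS]/= -exprSr -doubleS [LHS]even_moment /qvanish big_ord0.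
  by rewrite expr0 !mul1r divff ?D0 // !mul1r.
(* The odd constant of rank [n] times the leading coefficient in [q ^+ k]
   that the even step produces. *)
pose c' := c * (q ^+ n * (1 - a * b * q ^+ n.+1) / (1 - a * b * q ^+ n.*2.+1))
   * (- (a * q) * (1 - b * q ^+ n.+1) / (1 - a * b * q ^+ n.*2.+2)).
have even_step k : u ('X^(k.*2) * B n.+1.*2) =
    c' * qvanish n.+1 k * (qpoch (a * q) k / qpoch (a * b * q ^+ 2) (n.+1 + k)).
  rewrite doubleS mixed_momentSS sym_gamma_odd; have [-> ->] := IH k.
  rewrite qvanishS addSn !qpochS /c' /gamma_odd.
  have := qpoch_neq0 (n + k); move: (qpoch _ (n + k)) => P P0.
  move: (D0 n.*2.+1) (D0 n.*2.+2) (D0 (n + k).+2).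
  rewrite mul2n !addn1 !addn2 -!addnn !exprS !exprD.
  move: (q ^+ n) (q ^+ k) (qpoch _ k) (qvanish _ _) => Q K A V d1 d2 d3.
  by field; rewrite -!mulrA in d1 d2 d3 *; rewrite P0 d1 d2 d3.
exists c' => k; split => //.
rewrite mixed_momentSS.
have -> : u ('X^(k.*2.+2) * B n.+1.*2) = u ('X^(k.+1.*2) * B n.+1.*2) by [].
rewrite even_step sym_gamma_even (IH k).2.
rewrite qvanishSS qvanishS !addSn !addnS !qpochS /c' /gamma_even.
have := qpoch_neq0 (n + k); move: (qpoch _ (n + k)) => P P0.
move: (D0 n.*2.+1) (D0 n.*2.+2) (D0 n.*2.+3) (D0 (n + k).+2) (D0 (n + k).+3).
rewrite mul2n !addn1 !addn2 !addn3 -!addnn !addSn !addnS !exprS !exprD.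
move: (q ^+ n) (q ^+ k) (qpoch _ k) (qvanish _ _) => Q K A V d1 d2 d3 d4 d5.
by field; rewrite -!mulrA in d1 d2 d3 d4 d5 *; rewrite P0 d1 d2 d3 d4 d5.
Qed.

Lemma mixed_moment_vanish n k : (k < n)%N -> u ('X^k * B n) = 0.
Proof.
move=> lt_kn; case: (boolP (odd (k + n))) => [|]; first exact: mixed_moment_odd.
rewrite oddD negb_add => /eqP par.
have lt_half : (k./2 < n./2)%N.
  rewrite ltnNge; apply: contraL lt_kn => le_nk; rewrite -leqNgt.
  by rewrite -(odd_double_half n) -(odd_double_half k) par leq_add2l leq_double.
have [c /(_ k./2) [ev od]] := mixed_moments n./2.
rewrite -(odd_double_half n) -(odd_double_half k) par.
case: (odd n); rewrite ?add0n ?add1n.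
  by rewrite od qvanish_eq0 // mulr0 mul0r.
by rewrite ev qvanish_eq0 // mulr0 mul0r.
Qed.

Lemma sym_little_qJacobi_orthogonal : monic_orthogonal u B.
Proof.
exact: (sym_ops_orthogonal u0 usym sym_gamma_neq0 mixed_moment_vanish).
Qed.

End MixedMoments.

(** * The class condition *)

Section ClassCondition.
Variables (C : fieldType) (p d k l m : C).
Hypothesis p1 : p != 1.

Local Notation Phi := ('X * ('X^2 - d%:P) : {poly C}).
Local Notation Psi := (k *: (l *: 'X^2 + m%:P) : {poly C}).

Lemma hahn_cubic : hahn p Phi = (p ^+ 2 + p + 1) *: 'X^2 - d%:P.
Proof.
have p10 : p - 1 != 0 by rewrite subr_eq0.
have X0 : (p - 1) *: 'X != 0 :> {poly C} by rewrite scaler_eq0 negb_or p10 polyX_eq0.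
apply: (mulIf X0); rewrite hahnE // comp_polyM comp_polyB comp_polyX comp_polyC.
rewrite comp_Xn_poly -!mul_polyC !(rmorphB, rmorphD, rmorphXn, polyC1) /=.
by ring.
Qed.

Lemma theta_even_quadratic e : theta e Psi = (k * l) *: ('X + e%:P).
Proof.
have Xe0 : 'X - e%:P != 0 :> {poly C} by rewrite polyXsubC_eq0.
apply: (mulIf Xe0); rewrite thetaE !hornerE -!mul_polyC.
rewrite ?(rmorphB, rmorphD, rmorphM, rmorphXn, polyC1) /=.
by ring.
Qed.

Lemma theta2_cubic c e : c ^+ 2 = d ->
  theta e (theta c Phi) = 'X + (e + c)%:P.
Proof.
move=> cd; have Xc0 x : 'X - x%:P != 0 :> {poly C} by rewrite polyXsubC_eq0.
have -> : theta c Phi = 'X * ('X + c%:P).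
  by apply: (mulIf (Xc0 c)); rewrite thetaE !hornerE -cd; ring.
by apply: (mulIf (Xc0 e)); rewrite thetaE !hornerE; ring.
Qed.

Lemma class_value c : p * Psi.[p * c] + (hahn p Phi).[c] =
  p * (k * (l * (p * c) ^+ 2 + m)) + ((p ^+ 2 + p + 1) * c ^+ 2 - d).
Proof. by rewrite hahn_cubic !hornerE; ring. Qed.

Lemma class_functional (u : {scalar {poly C}}) c :
  moment u 0 = 1 -> moment u 1 = 0 -> c ^+ 2 = d ->
  u (p *: theta (c * p) Psi + theta (c * p) (theta c Phi)) =
  p * (k * l * (c * p)) + (c * p + c).
Proof.
move=> u0 u1 cd; have uXc x : u ('X + x%:P) = x.
  by rewrite linearD /= [u 'X]u1 add0r -[x%:P]alg_polyC scalarZ [u 1]u0 mulr1.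
by rewrite theta_even_quadratic theta2_cubic // linearD /= !scalarZ !uXc.
Qed.

Lemma monic_cubic : Phi \is monic.
Proof. by rewrite rpredM ?monicX ?monicXnsubC. Qed.

Lemma size_cubic : size Phi = 4.
Proof.
by rewrite -commr_polyX size_mulX ?size_XnsubC // monic_neq0 ?monicXnsubC.
Qed.

Lemma size_even_quadratic : k != 0 -> l != 0 -> size Psi = 3.
Proof.
move=> k0 l0; rewrite size_scale // size_polyDl size_scale ?size_polyXn //.
by rewrite (leq_ltn_trans (size_polyC_leq1 _)).
Qed.

End ClassCondition.

Section ClassConditionRoots.
Variables (C : numClosedFieldType) (a b q p : C) (u : {scalar {poly C}}).
Hypotheses (pq : p ^+ 2 = q) (q0 : q != 0) (q1 : q != 1).
Hypotheses (a0 : a != 0) (b0 : b != 0) (ap : a != p^-1) (abq1 : a * b != q^-1).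
Hypotheses (u0 : moment u 0 = 1) (u1 : moment u 1 = 0).

(** At the nonzero zeros [c] the first term equals [b^-1 - 1] up to a nonzero
    factor; as [b = 1] is possible, only the second term is positive there in
    all cases. *)
Lemma class_condition_sym :
  class_condition p ('X * ('X^2 - (b^-1 * q^-1)%:P))
    ((a * b * q ^+ 2 * (p - 1))^-1 *:
       ((1 - a * b * q ^+ 2) *: 'X^2 + (a * q - 1)%:P)) u.
Proof.
have p1 : p != 1 by apply: contraNneq q1 => p1; rewrite -pq p1 expr1n.
have p0 : p != 0 by apply: contraNneq q0 => p0; rewrite -pq p0 expr0n.
have p10 : p - 1 != 0 by rewrite subr_eq0.
(* A product over an infinite support is 1 by convention. *)
rewrite /class_condition; case: finite_supportP => [_|X XP _ _].
  by rewrite big_nil ltr01.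
rewrite big_seq prodr_gt0 // => c cX.
have: root ('X * ('X^2 - (b^-1 / q)%:P)) c by exact: XP.
rewrite rootM -[X in root X]subr0 root_XsubC => cphi.
rewrite lt_def addr_ge0 // andbT paddr_eq0 // !normr_eq0 negb_and.
have K0 : a * b * q ^+ 2 * (p - 1) != 0 by rewrite !mulf_neq0 ?expf_neq0.
rewrite class_value //.
case/orP: cphi => [/eqP ->|/eqP].
  apply/orP; left.
  have -> : p * ((a * b * q ^+ 2 * (p - 1))^-1 *
      ((1 - a * b * q ^+ 2) * (p * 0) ^+ 2 + (a * q - 1))) +
      ((p ^+ 2 + p + 1) * 0 ^+ 2 - b^-1 / q) =
      p * (a * p - 1) / (a * b * q ^+ 2 * (p - 1)).
    by rewrite -pq; field; rewrite p0 p10 a0 b0.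
  rewrite !mulf_neq0 ?invr_eq0 // subr_eq0.
  by apply: contra_neq ap => ap1; rewrite -[a](mulfK p0) ap1 mul1r.
rewrite hornerD hornerN hornerXn hornerC => /subr0_eq c2; apply/orP; right.
have c0 : c != 0.
  by rewrite -sqrf_eq0 c2 mulf_neq0 ?invr_eq0.
rewrite class_functional //.
have -> : p * ((a * b * q ^+ 2 * (p - 1))^-1 * (1 - a * b * q ^+ 2) * (c * p)) +
    (c * p + c) = c * (1 - a * b * q) / (a * b * q * (p - 1)).
  by rewrite -pq; field; rewrite p0 p10 a0 b0.
rewrite !mulf_neq0 ?invr_eq0 ?mulf_neq0 // subr_eq0 eq_sym.
by apply: contra_neq abq1 => ab1; rewrite -[a * b](mulfK q0) ab1 mul1r.
Qed.

End ClassConditionRoots.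

(** * The symmetrized little q-Jacobi form *)

Theorem mainTheorem7 (R : realType) (q a b : R[i])
  (hq : in_Ctilde q)
  (hab : a * b != 0)
  (ha_half : a != (sqrtc q)^-1)
  (ha : forall n : nat, a != q ^- n.+1)
  (hb : forall n : nat, b != q ^- n.+1)
  (habq : forall n : nat, a * b != q ^- n)
  (U u : {scalar {poly R[i]}})
  (hU : little_qJacobi a b q U)
  (hsym : symmetrical u)
  (hsigma : sigma_form u =1 U) :
  [/\ semiclassical_of_class (sqrtc q) u 1,
      hahn_equation (sqrtc q)
        ('X * ('X^2 - (b^-1 * q^-1)%:P))
        ((a * b * q ^+ 2 * (sqrtc q - 1))^-1 *:
           ((1 - a * b * q ^+ 2) *: 'X^2 + (a * q - 1)%:P)) u
    & exists2 gamma : nat -> R[i],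
        recurrence_coefficients u (fun=> 0) gamma
      & forall n : nat,
          gamma (2 * n + 1)%N =
            q ^+ n * ((1 - a * q ^+ (n + 1)) * (1 - a * b * q ^+ (n + 1)))
            / ((1 - a * b * q ^+ (2 * n + 1)) * (1 - a * b * q ^+ (2 * n + 2)))
          /\
          gamma (2 * n + 2)%N =
            a * q ^+ (n + 1) * ((1 - q ^+ (n + 1)) * (1 - b * q ^+ (n + 1)))
            / ((1 - a * b * q ^+ (2 * n + 2)) * (1 - a * b * q ^+ (2 * n + 3)))].
Proof.
have [q0 q1] := hq; have q1' : q != 1 by rewrite -[q]expr1 q1.
have pq : sqrtc q ^+ 2 = q by exact: sqr_sqrtc.
set p := sqrtc q in pq ha_half *.
have p1 : p != 1 by apply: contraNneq q1' => p1; rewrite -pq p1 expr1n.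
have p10 : p - 1 != 0 by rewrite subr_eq0.
have /andP[a0 b0] : (a != 0) && (b != 0) by rewrite -negb_or -mulf_eq0.
have uU n : moment u n.*2 = moment U n.
  by rewrite /moment -hsigma /sigma_form comp_Xn_poly -exprM mul2n.
have u0 : moment u 0 = 1 by rewrite -double0 uU; case: hU.
have urec n : (1 - a * b * q ^+ n.+2) * moment u n.+1.*2 =
              (1 - a * q ^+ n.+1) * moment u n.*2.
  by rewrite !uU (little_qJacobi_moment_rec n q0 q1' hab hU).
have oB := sym_little_qJacobi_orthogonal hq hab ha hb habq u0 hsym urec.
have hahn_u : hahn_equation p ('X * ('X^2 - (b^-1 * q^-1)%:P))
    ((a * b * q ^+ 2 * (p - 1))^-1 *:
       ((1 - a * b * q ^+ 2) *: 'X^2 + (a * q - 1)%:P)) u.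
  by apply: sym_hahn_equation.
have K0 : (a * b * q ^+ 2 * (p - 1))^-1 != 0.
  by rewrite invr_eq0 !mulf_neq0 ?expf_neq0.
have l0 : 1 - a * b * q ^+ 2 != 0 by exact: subr1_neq0.
split=> //.
  split; first by split=> //; exists (sym_ops (sym_gamma a b q)).
  do 2!eexists; split; first split; try exact: hahn_u.
  - exact: monic_cubic.
  - by rewrite size_even_quadratic.
  - apply: class_condition_sym => //; first exact: (habq 1).
    exact: (hsym 0).
  - by rewrite size_even_quadratic // size_cubic.
exists (sym_gamma a b q).
  by apply: sym_ops_recurrence oB => n; apply: sym_gamma_neq0.
move=> n; rewrite -/(gamma_odd a b q n) -/(gamma_even a b q n).
by rewrite -sym_gamma_odd -sym_gamma_even mul2n addn1 addn2.
Qed.
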